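(* Let $\mathcal{F}\subseteq\mathbb{R}^n$ be a finite set, $T=\operatorname{conv}(\mathcal{F})$, $E\subseteq\{(i,j)\in\mathbb{N}^2\mid 1\le i<j\le n\}$, $a_{ij}\in\mathbb{R}$ for $(i,j)\in E$, and let $f\colon\mathcal{F}\to\mathbb{R}$ be the bilinear function $f(x)=\sum_{(i,j)\in E}a_{ij}x_ix_j$. Then for all $x\in T$, \[ \operatorname{vex}[f](x)=\min\Big\{\sum_{(i,j)\in E}a_{ij}M(S_i,S_j)\ \Big|\ (S_1,\ldots,S_n)\in\bar Z(x)\Big\}, \] \[ \operatorname{cav}[f](x)=\max\Big\{\sum_{(i,j)\in E}a_{ij}M(S_i,S_j)\ \Big|\ (S_1,\ldots,S_n)\in\bar Z(x)\Big\}. \] In particular, for a polytope $P\subseteq\mathbb{R}^{n(n+1)/2}$ with $\pi[f](P)\subseteq X(f)$, we have $\pi[f](P)=X(f)$ if and only if for every $x\in T$ there are sets $(S_1,\ldots,S_n)\in\bar Z(x)$ and $(S'_1,\ldots,S'_n)\in\bar Z(x)$ with \[ \sum_{(i,j)\in E}a_{ij}M(S_i,S_j)=\operatorname{LB}_P[f](x),\qquad \sum_{(i,j)\in E}a_{ij}M(S'_i,S'_j)=\operatorname{UB}_P[f](x). \]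
   Context: Let $U=[0,1)$. A rectangle over $U$ is a pair $R=([a,b),c)$ with $[a,b)\subseteq U$, $a<b$, $c\in\mathbb{R}$, $c\neq 0$; put $q(R)=(b-a)c$ and $z(R)=c$. For $t\in U$ let $y(t,R)=1$ if $a\le t<b$ ($R$ is active at $t$) and $y(t,R)=0$ otherwise. Two rectangles $R_1,R_2$ are non-overlapping if there is no $t\in U$ with $y(t,R_1)=y(t,R_2)=1$. $\bar{\mathcal{L}}^U$ is the set of all finite (possibly empty) families $S=\{R_1,\ldots,R_k\}$ of pairwise non-overlapping rectangles. For such $S$, $\bar\mu^U(S)=\sum_{i=1}^k q(R_i)$; for $t\in U$, $\bar\phi^U(t,S)=z(R)$ if some (necessarily unique) $R\in S$ is active at $t$, and $\bar\phi^U(t,S)=0$ otherwise. Let $\bar\varphi^U(t,S_1,\ldots,S_n)=(\bar\phi^U(t,S_1),\ldots,\bar\phi^U(t,S_n))\in\mathbb{R}^n$. $\bar Z(x)$ is the set of all $(S_1,\ldots,S_n)\in(\bar{\mathcal{L}}^U)^n$ with $\bar\mu^U(S_i)=x_i$ for all $i\in\{1,\ldots,n\}$ and $\bar\varphi^U(t,S_1,\ldots,S_n)\in\mathcal{F}$ for all $t\in U$. The function $M\colon(\bar{\mathcal{L}}^U)^2\to\mathbb{R}$, a kind of generalized overlap, is \[ M(S_1,S_2)=\sum_{R^1\in S_1}\sum_{R^2\in S_2} z(R^1)\,z(R^2)\,\lambda\big(\{t\in U\mid y(t,R^1)=1,\ y(t,R^2)=1\}\big), \] where $\lambda$ denotes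 Lebesgue measure. The convex hull of the graph of $f$ is $X(f)=\operatorname{conv}\{(x,z)\in T\times\mathbb{R}\mid z=f(x)\}$, where $x$ ranges over the domain $\mathcal{F}$ of $f$. The convex and concave envelopes of $f$ over $T$ are given, for $x\in T$, by $\operatorname{vex}[f](x)=\min\{z\in\mathbb{R}\mid (x,z)\in X(f)\}$ and $\operatorname{cav}[f](x)=\max\{z\in\mathbb{R}\mid (x,z)\in X(f)\}$. Points of $\mathbb{R}^{n(n+1)/2}$ are written $(x,y)$ with $x\in\mathbb{R}^n$ and $y=(y_{ij})_{1\le i<j\le n}$, where $y_{ij}$ represents the product $x_ix_j$. Let $\pi[f](x,y)=(x,\sum_{(i,j)\in E}a_{ij}y_{ij})\in\mathbb{R}^{n+1}$ and $\pi[f](P)=\{\pi[f](x,y)\mid(x,y)\in P\}$. The functions $\operatorname{LB}_P[f],\operatorname{UB}_P[f]\colon T\to\mathbb{R}$ are $\operatorname{LB}_P[f](x)=\min\{\sum_{(i,j)\in E}a_{ij}y_{ij}\mid(x,y)\in P\}$ and $\operatorname{UB}_P[f](x)=\max\{\sum_{(i,j)\in E}a_{ij}y_{ij}\mid(x,y)\in P\}$.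
   Formalization: In the ''in particular'' part the inclusion is reversed: the formal theorem assumes X(f) ⊆ π[f](P) and that every (x,y) in P has x in T, because with π[f](P) ⊆ X(f) as printed the ''if'' direction is false. *)

(* Defs.v *)
From HB Require Import structures.
From mathcomp Require Export all_boot all_order all_algebra finmap.
From mathcomp Require Export all_classical all_reals all_analysis.

Set Implicit Arguments.
Unset Strict Implicit.
Unset Printing Implicit Defensive.

Import Order.TTheory GRing.Theory Num.Theory.
Local Open Scope fset_scope.
Local Open Scope classical_set_scope.
Local Open Scope ring_scope.

(* Minima and maxima of sets of reals; [set_min] and [set_max] are only
   meaningful when they are attained and default to 0 otherwise. *)
Definition is_min (R : realType) (A : set R) (m : R) := A m /\ lbound A m.
Definition is_max (R : realType) (A : set R) (m : R) := A m /\ ubound A m.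
Definition set_min (R : realType) (A : set R) : R := xget 0 (is_min A).
Definition set_max (R : realType) (A : set R) : R := xget 0 (is_max A).

Definition conv_hull (R : realType) (V : lmodType R) (A : set V) : set V :=
  smallest (@convex_set R V) A.

Definition polytope (R : realType) (V : lmodType R) (P : set V) : Prop :=
  exists2 A : set V, finite_set A & P = conv_hull A.

(* [Rect rl rr rh] is the rectangle ([rl, rr), rh); the base [rl, rr) is
   contained in U = [0, 1) because rl < rr. *)
Record rect (R : realType) := Rect {
  rl : R;
  rr : R;
  rh : R;
  rl_ge0 : 0 <= rl;
  rl_lt_rr : rl < rr;
  rr_le1 : rr <= 1;
  rh_neq0 : rh != 0 }.

HB.instance Definition _ (R : realType) := gen_eqMixin (rect R).
HB.instance Definition _ (R : realType) := gen_choiceMixin (rect R).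

Section Families.
Variable R : realType.
Implicit Types (t : R) (r : rect R).

Definition unit_co : set R := `[0, 1[.

Definition area r : R := (rr r - rl r) * rh r.

Definition active t r : bool := rl r <= t < rr r.

Definition nonoverlapping r1 r2 : Prop :=
  ~ exists t, [/\ unit_co t, active t r1 & active t r2].

Record rfamily := RFamily {
  rects : {fset rect R};
  rects_nonoverlapping : forall r1 r2,
    r1 \in rects -> r2 \in rects -> r1 != r2 -> nonoverlapping r1 r2 }.

Definition mu_bar (S : rfamily) : R := \sum_(r <- rects S) area r.

Definition phi_bar t (S : rfamily) : R :=
  if [pick r : rects S | active t (val r)] is Some r then rh (val r) else 0.

Definition varphi_bar n t (S : 'I_n -> rfamily) : 'rV[R]_n :=
  \row_i phi_bar t (S i).

Definition Z_bar n (F : set 'rV[R]_n) (x : 'rV[R]_n) : set ('I_n -> rfamily) :=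
  [set S | (forall i, mu_bar (S i) = x 0 i) /\
           (forall t, unit_co t -> F (varphi_bar t S))].

Definition overlap (S1 S2 : rfamily) : R :=
  \sum_(r1 <- rects S1) \sum_(r2 <- rects S2) rh r1 * rh r2 *
    fine (lebesgue_measure [set t | [/\ unit_co t, active t r1 & active t r2]]).

End Families.

Section Envelopes.
Variables (R : realType) (n : nat) (F : set 'rV[R]_n) (f : 'rV[R]_n -> R).

Definition graph_hull : set ('rV[R]_n * R^o) :=
  conv_hull [set p : 'rV[R]_n * R^o | F p.1 /\ p.2 = f p.1].

Definition graph_hull_at (x : 'rV[R]_n) : set R := [set z | graph_hull (x, z)].

Definition vex (x : 'rV[R]_n) : R := set_min (graph_hull_at x).
Definition cav (x : 'rV[R]_n) : R := set_max (graph_hull_at x).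

End Envelopes.

(* The index set {(i, j) | i < j} of the product variables y_ij. *)
Notation upair n := {p : 'I_n * 'I_n | (p.1 < p.2)%N}.

(* The space R^(n(n+1)/2) of the points (x, y). *)
Notation lifted R n := ('rV[R]_n * {ffun upair n -> R^o})%type.

Section Bilinear.
Variables (R : realType) (n : nat) (E : {set upair n}) (a : upair n -> R).

Definition bilin (x : 'rV[R]_n) : R :=
  \sum_(p in E) a p * x 0 (val p).1 * x 0 (val p).2.

Definition lin_y (y : {ffun upair n -> R^o}) : R := \sum_(p in E) a p * y p.

Definition proj_f (p : lifted R n) : 'rV[R]_n * R^o := (p.1, lin_y p.2).

Definition LB (P : set (lifted R n)) (x : 'rV[R]_n) : R :=
  set_min [set lin_y y | y in [set y | P (x, y)]].
Definition UB (P : set (lifted R n)) (x : 'rV[R]_n) : R :=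
  set_max [set lin_y y | y in [set y | P (x, y)]].

Definition sum_overlap (S : 'I_n -> rfamily R) : R :=
  \sum_(p in E) a p * overlap (S (val p).1) (S (val p).2).

End Bilinear.

(* Main.v *)
From HB Require Import structures.
Require Import Defs.
From mathcomp Require Import lra ring measurable_realfun.

(** The generalized overlap of two families is the integral over U = [0, 1) of the
    product of their step functions ([overlap_Rintegral]), and the total area of a
    family is the integral of its step function ([mu_bar_Rintegral]). For a tuple S
    in [Z_bar F x], the function t |-> [varphi_bar t S] is a step function with
    values in the finite set F. Let w_v be the length of the set of times at which
    it takes the value v. The w_v are convex weights and, integrating,

      x = \sum_v w_v v   and   sum_overlap S = \sum_v w_v f(v),

    so (x, sum_overlap S) is a point of the convex hull of the graph of f.
    Conversely, given convex weights w_v with \sum_v w_v v = x, cut U into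
    consecutive cells of lengths w_v and let the i-th family have height v_i on the
    cell of v ([cell_steps]): this produces a tuple in [Z_bar F x] with the
    prescribed overlap. Hence the set of overlaps over [Z_bar F x] is exactly the
    fibre of the graph hull above x ([graph_hull_overlaps]). That fibre has a least
    and a greatest element by compactness of the set of weights
    ([conv_hull_fiber_min]), which gives the formulas for both envelopes.

    For a polytope P whose projection contains the graph hull, LB and UB are the
    ends of the fibres of the projection ([lin_y_fiber], [polytope_fiber_extrema]).
    If the projection equals the graph hull, they are the two envelopes and so are
    overlaps. If they are overlaps, both ends lie in the graph hull, and so does
    everything between them, as the fibres of a convex set are intervals
    ([graph_hull_between]). *)

Set Implicit Arguments.
Unset Strict Implicit.
Unset Printing Implicit Defensive.

Import Order.TTheory GRing.Theory Num.Theory.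
Import numFieldNormedType.Exports.
Local Open Scope classical_set_scope.
Local Open Scope ring_scope.

(** * Convex hulls of finite sets *)

Definition convex_weights (R : realType) m (w : 'I_m -> R) : Prop :=
  (forall k, 0 <= w k) /\ \sum_k w k = 1.

(** Indexing a finite set by ordinals, without repetition, lets sums over its
    points be taken over ['I_m]; injectivity makes the level sets of a function
    with values in the set disjoint. *)
Lemma finite_set_range (T : choiceType) (A : set T) : finite_set A ->
  exists m (v : 'I_m -> T), injective v /\ A = range v.
Proof.
move=> /finite_seqP[s ->]; pose r := undup s.
exists (size r), (tnth (in_tuple r)); split.
  by apply/tuple_uniqP; rewrite undup_uniq.
apply/seteqP; split=> x /=.
  rewrite -mem_undup => xr.
  by have /tnthP[k ->] : x \in in_tuple r by []; exists k.
by move=> [k _ <-]; rewrite -mem_undup; apply: mem_tnth.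
Qed.

Section ConvexHull.
Variables (R : realType) (V : lmodType R).

Lemma convex_setP (A : set V) :
  @convex_set R V A <-> forall x y t, 0 <= t -> t <= 1 -> A x -> A y ->
    A (t *: x + (1 - t) *: y).
Proof.
split=> [cA x y t t0 t1 Ax Ay | cA x y l].
  by have := cA x y (Itv01 t0 t1); rewrite !inE; apply.
by rewrite !inE => Ax Ay; apply: cA.
Qed.

(** The weights are only required to have a positive sum so that the induction
    can drop the last point without renormalizing the remaining weights. *)
Lemma conic_combination (A : set V) m (v : 'I_m -> V) (w : 'I_m -> R) :
  @convex_set R V A -> (forall k, A (v k)) -> (forall k, 0 <= w k) ->
  0 < \sum_k w k -> A ((\sum_k w k)^-1 *: \sum_k w k *: v k).
Proof.
move=> /convex_setP cA; elim: m v w => [|m IH] v w Av w0.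
  by rewrite big_ord0 ltxx.
rewrite !big_ord_recr /=; set W := \sum_(k < m) _; set z := \sum_(k < m) _.
set c := w ord_max => Wc0.
have c0 : 0 <= c by apply: w0.
have : 0 <= W by apply: sumr_ge0.
rewrite le_eqVlt => /orP[/eqP W0 | W0].
  have -> : z = 0.
    apply: big1 => k _; suff -> : w (widen_ord (leqnSn m) k) = 0.
      by rewrite scale0r.
    by apply: (psumr_eq0P _ (esym W0)).
  rewrite -W0 !add0r scalerA mulVf ?scale1r //.
  by rewrite -W0 add0r in Wc0; rewrite gt_eqF.
have -> : (W + c)^-1 *: (z + c *: v ord_max) =
    (W / (W + c)) *: (W^-1 *: z) + (1 - W / (W + c)) *: v ord_max.
  rewrite scalerDr !scalerA; congr (_ *: _ + _ *: _); field;
    rewrite ?gt_eqF //.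
apply: cA => //; first by rewrite divr_ge0 // ltW.
- by rewrite ler_pdivrMr // mul1r lerDl.
- exact: IH.
Qed.

Lemma conv_hull_convex (A : set V) : @convex_set R V (conv_hull A).
Proof.
apply/convex_setP => x y t t0 t1 Ax Ay B [cB AB].
by move/convex_setP: (cB); apply=> //; [apply: Ax | apply: Ay].
Qed.

(** The weighted means form a convex set containing the points, and every convex
    set containing the points contains them: the smallest convex set is thus the
    set of weighted means. *)
Lemma conv_hull_range m (v : 'I_m -> V) (p : V) :
  conv_hull (range v) p <->
  exists2 w, convex_weights w & p = \sum_k w k *: v k.
Proof.
split=> [|[w [w0 w1] ->]]; last first.
  have := @conic_combination (conv_hull (range v)) m v w
    (@conv_hull_convex _).
  rewrite w1 invr1 scale1r; apply=> // k.
  by apply: sub_gen_smallest; exists k.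
apply: (@smallest_sub _ _ _
  [set p | exists2 w, convex_weights w & p = \sum_k w k *: v k]).
  apply/convex_setP => _ _ t t0 t1 [w [w0 w1] ->] [u [u0 u1] ->].
  exists (fun k => t * w k + (1 - t) * u k).
    split=> [k|]; first by rewrite addr_ge0 ?mulr_ge0 ?subr_ge0.
    by rewrite big_split /= -!mulr_sumr w1 u1; ring.
  apply: (etrans
    (y := \sum_k (t * w k) *: v k + \sum_k ((1 - t) * u k) *: v k)).
    rewrite !scaler_sumr.
    by congr (_ + _); apply: eq_bigr => k _; rewrite scalerA.
  by rewrite -big_split; apply: eq_bigr => k _; rewrite scalerDl.
move=> _ [k _ <-]; exists (fun l => (l == k)%:R).
  split=> [l|]; first by rewrite ler0n.
  by rewrite (bigD1 k) //= eqxx big1 ?addr0 // => l /negPf ->.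
rewrite (bigD1 k) //= eqxx scale1r big1 ?addr0 // => l /negPf ->.
by rewrite scale0r.
Qed.

Lemma dot_continuous m (c : 'I_m -> R) :
  continuous (fun w : 'rV[R]_m => \sum_k w 0 k * c k).
Proof.
apply: continuous_big => [|k _ w]; first exact: add_continuous.
apply: (@continuousM R _ (fun w : 'rV[R]_m => w 0 k) (fun=> c k)).
  exact: coord_continuous.
exact: cst_continuous.
Qed.

(** The weights that represent the points of the fibre of [x] form a closed subset
    of the cube [[0, 1]^m], hence a compact one, and [h] is a continuous function
    of the weights: it attains its minimum.  Working with weights avoids any
    topology on [V]. *)
Lemma conv_hull_fiber_min n (A : set V) (g : {linear V -> 'rV[R]_n})
    (h : V -> R^o) (x : 'rV[R]_n) : linear h ->
  finite_set A -> (exists2 p, conv_hull A p & g p = x) ->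
  exists m : R,
    is_min [set (h p : R) | p in [set p | conv_hull A p /\ g p = x]] m.
Proof.
move=> hlin /finite_set_range[m [v [_ ->]]] [p0 p0A gp0].
pose h' : {linear V -> R^o} := HB.pack h (GRing.isLinear.Build _ _ _ _ h hlin).
have gE (w : 'I_m -> R) i :
    g (\sum_k w k *: v k) 0 i = \sum_k w k * g (v k) 0 i.
  by rewrite linear_sum summxE; apply: eq_bigr => k _; rewrite linearZ mxE.
have hE (w : 'I_m -> R) : h (\sum_k w k *: v k) = \sum_k w k * h (v k).
  have h'E : h =1 h' by [].
  by rewrite h'E linear_sum; apply: eq_bigr => k _; rewrite linearZ.
(* Closed linear constraints inside the unit cube. *)
pose K := [set w : 'rV[R]_m | forall k, `[0, 1]%classic (w 0 k)] `&`
  ([set w | \sum_k w 0 k * 1 = 1] `&`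
   \bigcap_i [set w | \sum_k w 0 k * g (v k) 0 i = x 0 i]).
have KP w : K w <->
    convex_weights (w 0) /\ g (\sum_k w 0 k *: v k) = x.
  split=> [[w01 [w1 wx]] | [[w0 w1] wx]].
    split; first split.
    - by move=> k; have := w01 k; rewrite /= in_itv /= => /andP[].
    - by rewrite -w1; apply: eq_bigr => k _; rewrite mulr1.
    - by apply/rowP => i; rewrite gE; apply: wx.
  have w1' : \sum_k w 0 k * 1 = 1.
    by under eq_bigr do rewrite mulr1.
  split=> [k|].
    rewrite /= in_itv /= w0 /= -w1 (bigD1 k) //= lerDl sumr_ge0 //.
  by split=> // i _ /=; rewrite -wx gE.
have cK : compact K.
  apply: compact_closedI.
    apply: (@rV_compact R m (fun=> `[0, 1]%classic)) => k.
    exact: segment_compact.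
  have cl (c : 'I_m -> R) b :
      closed [set w : 'rV[R]_m | \sum_k w 0 k * c k = b].
    apply: (@preimage_closed _ _ (fun w : 'rV[R]_m => \sum_k w 0 k * c k)
      [set b]).
      by move=> w _; apply: dot_continuous.
    exact: closed_eq.
  by apply: closedI; [apply: cl | apply: closed_bigI => i _; apply: cl].
have K0 : K !=set0.
  have /conv_hull_range[w ww p0E] := p0A.
  have wE : (\row_k w k) 0 = w by apply/funext => k; rewrite mxE.
  by exists (\row_k w k); apply/KP; rewrite wE -p0E.
have ch : {within K, continuous (fun w : 'rV[R]_m => \sum_k w 0 k * h (v k))}.
  by apply: continuous_subspaceT; apply: dot_continuous.
have [w wK wmin] := compact_EVT_min K0 cK ch.
exists (\sum_k w 0 k * h (v k)); split.
  move: wK; rewrite inE => /KP[ww wx].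
  exists (\sum_k w 0 k *: v k); last by rewrite hE.
  by split=> //; apply/conv_hull_range; exists (w 0).
move=> _ [p [/conv_hull_range[u uu pE] gp] <-].
have uE : (\row_k u k) 0 = u by apply/funext => k; rewrite mxE.
have := wmin (\row_k u k); rewrite /= uE pE hE; apply.
by rewrite inE; apply/KP; rewrite uE -pE.
Qed.

Lemma conv_hull_fiber_max n (A : set V) (g : {linear V -> 'rV[R]_n})
    (h : V -> R^o) (x : 'rV[R]_n) : linear h ->
  finite_set A -> (exists2 p, conv_hull A p & g p = x) ->
  exists m : R,
    is_max [set (h p : R) | p in [set p | conv_hull A p /\ g p = x]] m.
Proof.
move=> hlin finA nonempty.
have nlin : linear (fun p => - h p : R^o).
  by move=> c u w; rewrite hlin opprD scalerN.
have [m [[p pA hp] lbm]] := conv_hull_fiber_min nlin finA nonempty.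
exists (- m); split; first by exists p; rewrite -?hp ?opprK.
move=> _ [q qA <-]; rewrite lerNr; apply: lbm; by exists q.
Qed.

End ConvexHull.

(** * Integrals of step functions *)

Section StepFunctions.
Context d (X : measurableType d) (R : realType).
Variables (mu : {measure set X -> \bar R}) (D : set X).
Hypotheses (mD : measurable D) (finD : (mu D < +oo)%E).

Lemma integrable_indicZ A c : measurable A ->
  mu.-integrable D (EFin \o (fun t => c * \1_A t)).
Proof.
move=> mA; apply: (integrableZl mD c (f := EFin \o \1_A)).
apply: measurable_bounded_integrable => //.
exists 1; split=> // M M1 t _ /=; rewrite indicE.
by case: (t \in A); rewrite /= ?normr1 ?normr0 ltW // (lt_trans _ M1).
Qed.

(** The sum may have repeated or overlapping sets, so the integral of a function
    given by rectangles does not depend on how it is decomposed. *)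
Lemma Rintegral_sum_indic (I : Type) (s : seq I) (c : I -> R) (A : I -> set X) :
  (forall i, measurable (A i)) ->
  \int[mu]_(t in D) (\sum_(i <- s) c i * \1_(A i) t) =
  \sum_(i <- s) c i * fine (mu (A i `&` D)).
Proof.
move=> mA; elim: s => [|i s IH].
  by under eq_Rintegral do rewrite big_nil;
    rewrite big_nil Rintegral_cst ?mul0r.
under eq_Rintegral do rewrite big_cons.
rewrite RintegralD //; last 2 first.
- exact: integrable_indicZ.
- rewrite [X in _.-integrable _ X](_ : _ =
    (fun t => \sum_(i <- s) (c i * \1_(A i) t)%:E)%E); last first.
    by apply/funext => t /=; rewrite sumEFin.
  by apply: integrable_sum => // j _; apply: integrable_indicZ.
rewrite big_cons IH; congr (_ + _).
rewrite RintegralZl //; last first.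
  have := integrable_indicZ 1 (mA i).
  by congr (_.-integrable _ _); apply/funext => t /=; rewrite mul1r.
by rewrite /Rintegral integral_indic.
Qed.

(** [phi] is constant, with value [v k], on the piece [B k] of [D]; the
    sets [B k] cut [D] into disjoint pieces, some of which may be empty. *)
Definition steps m T (B : 'I_m -> set X) (v : 'I_m -> T) (phi : X -> T) :=
  (forall k, measurable (B k)) /\
  forall t, D t -> exists k, phi t = v k /\ forall l, (t \in B l) = (l == k).

Lemma Rintegral_steps m T (B : 'I_m -> set X) (v : 'I_m -> T) phi (G : T -> R) :
  steps B v phi ->
  \int[mu]_(t in D) (G (phi t)) = \sum_k fine (mu (B k `&` D)) * G (v k).
Proof.
move=> [mB phiB]; under eq_bigr do rewrite mulrC.
rewrite -Rintegral_sum_indic //; apply: eq_Rintegral => t; rewrite inE.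
move=> /phiB[k [-> tB]]; rewrite (bigD1 k) //= indicE tB eqxx mulr1.
by rewrite big1 ?addr0 // => l /negPf lk; rewrite indicE tB lk mulr0.
Qed.

(** When [D] has measure 1 the measures of the pieces are convex weights: a step
    function is a convex combination of its values. *)
Lemma steps_weights m T (B : 'I_m -> set X) (v : 'I_m -> T) phi :
  mu D = 1%E -> steps B v phi ->
  convex_weights (fun k => fine (mu (B k `&` D))).
Proof.
move=> D1 st; split=> [k|]; first exact: fine_ge0.
have := Rintegral_steps (fun=> 1) st; rewrite Rintegral_cst //.
rewrite D1 mul1r /= => ->.
by apply: eq_bigr => k _; rewrite mulr1.
Qed.

End StepFunctions.

(** * Families of rectangles as step functions on U *)

Section Families.
Variable R : realType.
Local Notation mu := (@lebesgue_measure R).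
Local Notation U := (@unit_co R).
Implicit Types (r : rect R) (S : rfamily R).

Definition len (A : set R) : R := fine (mu (A `&` U)).

(** The cast selects the sigma-algebra on which [lebesgue_measure] is defined. *)
Lemma measurable_unit_co : measurable (U : set (measurableTypeR R)).
Proof. exact: measurable_itv. Qed.

Lemma lebesgue_unit_co : mu U = 1%E.
Proof.
by rewrite /unit_co lebesgue_measure_itv /= lte_fin ltr01 -EFinB subr0. Qed.

Lemma lebesgue_unit_co_fin : (mu U < +oo)%E.
Proof. by rewrite lebesgue_unit_co ltry. Qed.

Lemma active_itv r : [set t | active t r] = `[rl r, rr r[%classic.
Proof. by apply/seteqP; split=> t; rewrite /= in_itv. Qed.

Lemma measurable_active r :
  measurable ([set t | active t r] : set (measurableTypeR R)).
Proof. by rewrite active_itv; apply: measurable_itv. Qed.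

Lemma active_unit_co t r : active t r -> U t.
Proof.
move=> /andP[rt tr]; rewrite /unit_co /= in_itv /=.
by rewrite (le_trans (rl_ge0 r)) //= (lt_le_trans tr (rr_le1 r)).
Qed.

Lemma lebesgue_itv_co (a b : R) : a <= b ->
  fine (mu `[a, b[%classic) = b - a.
Proof.
move=> ab; rewrite lebesgue_measure_itv /= lte_fin.
by case: ltrP => // ba; apply/eqP; rewrite eq_sym subr_eq0 eq_le ab ba.
Qed.

Lemma len_itv_co (a b : R) : 0 <= a -> a <= b -> b <= 1 ->
  len `[a, b[%classic = b - a.
Proof.
move=> a0 ab b1; rewrite -lebesgue_itv_co // /len; congr (fine (mu _)).
apply/setIidPl => t /=; rewrite /unit_co /= !in_itv /= => /andP[at_ tb].
by rewrite (le_trans a0) //= (lt_le_trans tb).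
Qed.

Lemma len_active r : len [set t | active t r] = rr r - rl r.
Proof. by rewrite active_itv len_itv_co ?rl_ge0 ?rr_le1 ?ltW ?rl_lt_rr. Qed.

(** At most one rectangle of a family is active at [t], so the height picked by
    [phi_bar] is the sum of the heights of all active rectangles. *)
Lemma phi_barE t S :
  phi_bar t S = \sum_(r <- rects S) rh r * \1_[set t | active t r] t.
Proof.
have indA r : \1_[set t | active t r] t = (active t r)%:R :> R.
  rewrite indicE; case tr: (active t r); first by rewrite mem_set.
  by rewrite memNset //= tr.
under eq_bigr do rewrite indA.
rewrite big_seq_fsetE /= /phi_bar; case: pickP => [r tr | none].
  rewrite (bigD1 r) //= tr mulr1 big1 ?addr0 // => q qr.
  case tq: (active t (val q)); last by rewrite mulr0.
  have vqr : val q != val r by rewrite val_eqE.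
  case: (rects_nonoverlapping (valP q) (valP r) vqr).
  by exists t; split=> //; apply: active_unit_co tr.
by rewrite big1 // => r _; rewrite none mulr0.
Qed.

Lemma measurable_phi_bar S : measurable_fun setT (fun t => phi_bar t S).
Proof.
under eq_fun do rewrite phi_barE.
apply: measurable_sum => r; apply: measurable_funM; first exact: measurable_cst.
by apply: measurable_indic; apply: measurable_active.
Qed.

Lemma mu_bar_Rintegral S : mu_bar S = \int[mu]_(t in U) phi_bar t S.
Proof.
under eq_Rintegral do rewrite phi_barE.
rewrite (Rintegral_sum_indic (mu:=mu) measurable_unit_co lebesgue_unit_co_fin);
  last exact: measurable_active.
by apply: eq_bigr => r _; rewrite -/(len _) len_active mulrC.
Qed.

(** By bilinearity: the product of the two sums of indicators is the sum, over the
    pairs of rectangles, of the indicators of the intersections of their bases. *)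
Lemma overlap_Rintegral S1 S2 :
  overlap S1 S2 = \int[mu]_(t in U) (phi_bar t S1 * phi_bar t S2).
Proof.
pose A (p : rect R * rect R) : set R :=
  [set t | active t p.1] `&` [set t | active t p.2].
transitivity (\int[mu]_(t in U)
  \sum_(p <- [seq (r1, r2) | r1 <- rects S1, r2 <- rects S2])
    (rh p.1 * rh p.2) * \1_(A p) t); last first.
  apply: eq_Rintegral => t _; rewrite !phi_barE big_allpairs mulr_suml.
  apply: eq_bigr => r1 _; rewrite mulr_sumr; apply: eq_bigr => r2 _ /=.
  by rewrite /A indicI /=; ring.
rewrite (Rintegral_sum_indic (mu:=mu) measurable_unit_co lebesgue_unit_co_fin);
  last first.
  by move=> p; apply: measurableI; apply: measurable_active.
rewrite big_allpairs; apply: eq_bigr => r1 _; apply: eq_bigr => r2 _.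
congr (_ * fine (mu _)); apply/seteqP.
by split=> t /=; [move=> [? ? ?] | move=> [[? ?] ?]].
Qed.

(** Placing a rectangle to the right of a family cannot create an overlap. *)
Lemma rect_family_add (S : rfamily R) (r : rect R) :
  (forall q, q \in rects S -> rr q <= rl r) ->
  exists2 S' : rfamily R, rects S' = (r |` rects S)%fset &
    forall t, phi_bar t S' = rh r * \1_[set t | active t r] t + phi_bar t S.
Proof.
move=> left_r.
have disj q : q \in rects S -> nonoverlapping q r /\ nonoverlapping r q.
  move=> qS; have qr := left_r _ qS.
  by split=> -[t [_ /andP[a1 a2] /andP[b1 b2]]];
    [have := le_lt_trans b1 (lt_le_trans a2 qr)
    |have := le_lt_trans a1 (lt_le_trans b2 qr)]; rewrite ltxx.
have ov q1 q2 : q1 \in (r |` rects S)%fset -> q2 \in (r |` rects S)%fset ->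
    q1 != q2 -> nonoverlapping q1 q2.
  rewrite !inE => /predU1P[-> | q1S] /predU1P[-> | q2S]; rewrite ?eqxx //.
  - by move=> _; case: (disj _ q2S).
  - by move=> _; case: (disj _ q1S).
  - exact: rects_nonoverlapping q1S q2S.
exists (RFamily ov) => // t; rewrite !phi_barE big_fsetU1 //=.
by apply/negP => /left_r; rewrite leNgt rl_lt_rr.
Qed.

End Families.

(** * Cutting U into consecutive cells of given lengths *)

Section Cells.
Variables (R : realType) (m : nat) (w : 'I_m -> R).
Hypothesis ww : convex_weights w.
Local Notation U := (@unit_co R).

Definition cumul (p : nat) : R := \sum_(j < m | (j < p)%N) w j.

Definition cell (k : 'I_m) : set R := `[cumul k, cumul k.+1[%classic.

Lemma cumulS (k : 'I_m) : cumul k.+1 = cumul k + w k.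
Proof.
rewrite /cumul (bigD1 k) //= addrC; congr (_ + _).
by apply: eq_bigl => j; rewrite ltnS [RHS]ltn_neqAle andbC.
Qed.

Lemma cumul0 : cumul 0 = 0.
Proof. exact: big_pred0_eq. Qed.

Lemma cumul_full : cumul m = 1.
Proof. by rewrite -ww.2; apply: eq_bigl => j; rewrite ltn_ord. Qed.

Lemma cumul_le p q : (p <= q)%N -> cumul p <= cumul q.
Proof.
move=> pq; rewrite /cumul big_mkcond [leRHS]big_mkcond; apply: ler_sum => j _.
case: ifP => [jp | _]; first by rewrite (leq_trans jp pq).
by case: ifP => // _; apply: ww.1.
Qed.

Lemma cumul_ge0 p : 0 <= cumul p.
Proof. by rewrite -cumul0 cumul_le. Qed.

Lemma cumul_le1 p : (p <= m)%N -> cumul p <= 1.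
Proof. by move=> pm; rewrite -cumul_full cumul_le. Qed.

Lemma len_cell k : len (cell k) = w k.
Proof.
rewrite len_itv_co ?cumul_ge0 ?cumul_le1 ?cumul_le //.
by rewrite cumulS addrC addKr.
Qed.

(** The cell of [t] is found from the least [q] such that [t < cumul q]; it is the
    cell of index [q - 1] because [cumul 0 = 0 <= t]. *)
Lemma cell_unique t : U t -> exists k, forall l, (t \in cell l) = (l == k).
Proof.
rewrite /unit_co /= in_itv /= => /andP[t0 t1].
have Pm : exists q, t < cumul q by exists m; rewrite cumul_full.
case: (ex_minnP Pm) => -[|q]; first by rewrite cumul0 ltNge t0.
move=> tq qmin; have qm : (q < m)%N by apply: qmin; rewrite cumul_full.
have qt : cumul q <= t.
  by rewrite leNgt; apply/negP => /qmin; rewrite ltnn.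
exists (Ordinal qm) => l; apply/idP/eqP => [|->]; last first.
  by rewrite inE /cell /= in_itv /= qt.
rewrite inE /cell /= in_itv /= => /andP[lt tl]; apply/val_inj/eqP => /=.
rewrite eqn_leq -ltnS -[X in _ && X]ltnS; apply/andP; split.
  by rewrite ltnNge; apply/negP => /cumul_le; rewrite leNgt (le_lt_trans lt tq).
by rewrite ltnNge; apply/negP => /cumul_le; rewrite leNgt (le_lt_trans qt tl).
Qed.

(** The family is built from left to right. A cell of length zero or of height
    zero contributes nothing, and gets no rectangle since a rectangle has a
    nonempty base and a nonzero height. *)
Lemma cell_family (c : 'I_m -> R) p : (p <= m)%N ->
  exists2 S : rfamily R, forall r, r \in rects S -> rr r <= cumul p &
    forall t, phi_bar t S = \sum_(k < m | (k < p)%N) c k * \1_(cell k) t.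
Proof.
elim: p => [_ | p IH pm].
  have ov (q1 q2 : rect R) : q1 \in (fset0 : {fset rect R}) ->
    q2 \in (fset0 : {fset rect R}) ->
    q1 != q2 -> nonoverlapping q1 q2 by rewrite inE.
  exists (RFamily ov) => [r | t]; first by rewrite /= inE.
  by rewrite phi_barE /= big_seq_fset0 big_pred0_eq.
have [S Sle Sphi] := IH (ltnW pm); pose k := Ordinal pm.
have splitk t : \sum_(j < m | (j < p.+1)%N) c j * \1_(cell j) t =
    c k * \1_(cell k) t + \sum_(j < m | (j < p)%N) c j * \1_(cell j) t.
  rewrite (bigD1 k) //=; congr (_ + _).
  by apply: eq_bigl => j; rewrite ltnS [RHS]ltn_neqAle andbC.
have Sle' r : r \in rects S -> rr r <= cumul p.+1.
  by move=> /Sle /le_trans; apply; apply: cumul_le.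
have [ck0 | ck0] := eqVneq (c k) 0.
  by exists S => // t; rewrite splitk ck0 mul0r add0r.
have := ww.1 k; rewrite le_eqVlt => /orP[/eqP wk0 | wk0].
  exists S => // t; rewrite splitk indicE memNset ?mulr0 ?add0r //.
  rewrite /cell /= (cumulS k) -wk0 addr0 in_itv /=.
  by move=> /andP[/le_lt_trans h/h]; rewrite ltxx.
have lt_ends : cumul p < cumul p.+1 by rewrite (cumulS k) ltrDl.
pose r := Rect (cumul_ge0 p) lt_ends (cumul_le1 pm) ck0.
have [S' S'E S'phi] := @rect_family_add R S r Sle.
exists S' => [q | t]; first by rewrite S'E !inE => /predU1P[-> | /Sle'].
by rewrite S'phi splitk Sphi active_itv.
Qed.

End Cells.

(** * The values of the generalized overlap over Z_bar *)

Section Overlaps.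
Variables (R : realType) (n : nat).
Local Notation mu := (@lebesgue_measure R).
Local Notation U := (@unit_co R).
Implicit Types (S : 'I_n -> rfamily R).

Local Notation steps_U := (@steps _ (measurableTypeR R) U).

Lemma mu_bar_steps m (B : 'I_m -> set R) (v : 'I_m -> 'rV[R]_n) S :
  steps_U B v (fun t => varphi_bar t S) -> forall i,
  mu_bar (S i) = \sum_k len (B k) * v k 0 i.
Proof.
move=> st i; rewrite mu_bar_Rintegral.
rewrite -(Rintegral_steps (mu := mu) (@measurable_unit_co R) (lebesgue_unit_co_fin R)
  (fun u : 'rV[R]_n => u 0 i) st).
by apply: eq_Rintegral => t _; rewrite mxE.
Qed.

Lemma sum_overlap_steps E a m (B : 'I_m -> set R) (v : 'I_m -> 'rV[R]_n) S :
  steps_U B v (fun t => varphi_bar t S) ->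
  sum_overlap E a S = \sum_k len (B k) * bilin E a (v k).
Proof.
move=> st; rewrite /bilin; under eq_bigr do rewrite mulr_sumr.
rewrite exchange_big; apply: eq_bigr => p _; rewrite overlap_Rintegral.
(* The integrand of the overlap, as a function of the value of [varphi_bar]. *)
pose G (u : 'rV[R]_n) := u 0 (val p).1 * u 0 (val p).2.
transitivity (a p * \sum_k len (B k) * G (v k)); last first.
  by rewrite mulr_sumr; apply: eq_bigr => k _; rewrite /G; ring.
rewrite -(Rintegral_steps (mu := mu) (@measurable_unit_co R) (lebesgue_unit_co_fin R)
  G st).
by congr (_ * _); apply: eq_Rintegral => t _; rewrite /G !mxE.
Qed.

Lemma level_steps m (v : 'I_m -> 'rV[R]_n) S : injective v ->
  (forall t, U t -> range v (varphi_bar t S)) ->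
  steps_U (fun k => [set t | varphi_bar t S = v k]) v (fun t => varphi_bar t S).
Proof.
move=> vinj Sv; split=> [k | t /Sv[k _ vk]]; last first.
  exists k; split=> // l; apply/idP/eqP => [|->]; last by rewrite inE /= vk.
  by rewrite inE /= -vk => /vinj.
have -> : [set t | varphi_bar t S = v k] =
    \bigcap_(i in [set: 'I_n]) ((fun t => phi_bar t (S i)) @^-1` [set v k 0 i]).
  apply/seteqP; split=> t /= h.
    by move=> i _ /=; rewrite -h mxE.
  by apply/rowP => i; rewrite mxE; apply: h.
apply: fin_bigcap_measurable => [|i _]; first exact: finite_finset.
rewrite -[_ @^-1` _]setTI; apply: (measurable_phi_bar (S i)) => //.
Qed.

(** Every choice of weights is realized: give the point [v k] a cell of length
    [w k] and stack the coordinates of [v k] above it, one family per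
    coordinate. *)
Lemma cell_steps m (w : 'I_m -> R) (v : 'I_m -> 'rV[R]_n) :
  convex_weights w ->
  exists S, steps_U (cell w) v (fun t => varphi_bar t S).
Proof.
move=> ww.
have /choice[S SP] : forall i, exists S : rfamily R, forall t,
    phi_bar t S = \sum_k v k 0 i * \1_(cell w k) t.
  move=> i; have [S _ SE] := cell_family ww (fun k => v k 0 i) (leqnn m).
  by exists S => t; rewrite SE; apply: eq_bigl => k; rewrite ltn_ord.
exists S; split=> [k | t /(cell_unique ww)[k tk]]; first exact: measurable_itv.
exists k; split=> //; apply/rowP => i; rewrite mxE SP (bigD1 k) //= indicE tk.
rewrite eqxx mulr1 big1 ?addr0 // => l /negPf lk.
by rewrite indicE tk lk mulr0.
Qed.

Lemma graph_hull_range m (v : 'I_m -> 'rV[R]_n) (f : 'rV[R]_n -> R) x z :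
  graph_hull (range v) f (x, z) <->
  exists2 w, convex_weights w &
    x = \sum_k w k *: v k /\ z = \sum_k w k * f (v k).
Proof.
have graphE : [set p : 'rV[R]_n * R^o | range v p.1 /\ p.2 = f p.1] =
    range (fun k => (v k, f (v k)) : 'rV[R]_n * R^o).
  apply/seteqP; split=> [[u y] /= [[k _ <-] ->] | _ [k _ <-]].
    by exists k.
  by split=> //; exists k.
have sumE (w : 'I_m -> R) :
    \sum_k w k *: ((v k, f (v k)) : 'rV[R]_n * R^o) =
    (\sum_k w k *: v k, \sum_k w k * f (v k)).
  by rewrite [LHS]surjective_pairing; congr (_, _);
    [rewrite (linear_sum fst) | rewrite (linear_sum snd)].
rewrite /graph_hull graphE conv_hull_range.
split=> -[w ww]; rewrite ?sumE; first by case=> -> ->; exists w.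
by move=> [-> ->]; exists w; rewrite ?sumE.
Qed.

(** A family tuple in [Z_bar F x] and a convex combination of points of the graph
    above [x] carry the same data: the weight of a point of [F] is the length of
    the set of times at which [varphi_bar] takes it as its value. *)
Lemma graph_hull_overlaps (F : set 'rV[R]_n) E a x : finite_set F ->
  graph_hull_at F (bilin E a) x = [set sum_overlap E a S | S in Z_bar F x].
Proof.
move=> /finite_set_range[m [v [vinj ->]]]; apply/seteqP; split=> z.
  move=> /graph_hull_range[w ww [xE zE]].
  have [S st] := cell_steps v ww.
  exists S; last first.
    by rewrite (sum_overlap_steps E a st) zE;
      apply: eq_bigr => k _; rewrite len_cell.
  split=> [i | t /st.2[k [-> _]]]; last by exists k.
  rewrite (mu_bar_steps st) xE summxE; apply: eq_bigr => k _.
  by rewrite len_cell // mxE.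
move=> [S [muS SF] <-]; apply/graph_hull_range.
have st := level_steps vinj SF.
eexists; first exact: (steps_weights (mu := mu) (@measurable_unit_co R)
  (lebesgue_unit_co_fin R) (lebesgue_unit_co R) st).
split; last exact: sum_overlap_steps.
apply/rowP => i; rewrite -muS (mu_bar_steps st) summxE.
by apply: eq_bigr => k _; rewrite mxE.
Qed.

End Overlaps.

(** * Extrema over the fibres of a polytope *)

Section Fibers.
Variables (R : realType) (n : nat).

Lemma set_minP (A : set R) : (exists m, is_min A m) -> is_min A (set_min A).
Proof. exact: xgetPex. Qed.

Lemma set_maxP (A : set R) : (exists m, is_max A m) -> is_max A (set_max A).
Proof. exact: xgetPex. Qed.

(** Both the graph hull, with [h] the identity, and the polytope of the lifted
    points, with [h] the linear form in the product variables, are instances. *)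
Lemma polytope_fiber_extrema (W : lmodType R) (P : set ('rV[R]_n * W)%type)
    (h : W -> R^o) (x : 'rV[R]_n) :
  linear h -> polytope P -> (exists y, P (x, y)) ->
  let A := [set (h y : R) | y in [set y | P (x, y)]] in
  is_min A (set_min A) /\ is_max A (set_max A).
Proof.
move=> hlin [C finC ->] [y Py] A.
have hsnd : linear (fun p : 'rV[R]_n * W => h p.2 : R^o).
  by move=> c u w; exact: hlin.
have nonempty : exists2 p, conv_hull C p & fst p = x by exists (x, y).
have AE : A = [set (h p.2 : R) | p in [set p | conv_hull C p /\ fst p = x]].
  apply/seteqP; split=> [_ [z Cz <-] | _ [[u z] /= [Cz ux] <-]].
    by exists (x, z).
  by exists z; rewrite //= -ux.
split.
  by apply: set_minP; rewrite AE; apply: (conv_hull_fiber_min (g := fst) hsnd).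
by apply: set_maxP; rewrite AE; apply: (conv_hull_fiber_max (g := fst) hsnd).
Qed.

Variables (F : set 'rV[R]_n) (f : 'rV[R]_n -> R).

Lemma graph_hull_polytope : finite_set F -> polytope (graph_hull F f).
Proof.
move=> finF; exists [set p : 'rV[R]_n * R^o | F p.1 /\ p.2 = f p.1] => //.
apply: sub_finite_set (finite_image (fun u => (u, f u) : 'rV[R]_n * R^o) finF).
by move=> [u z] /= [Fu ->]; exists u.
Qed.

Lemma graph_hull_at_nonempty x : finite_set F -> conv_hull F x ->
  exists z, graph_hull F f (x, z).
Proof.
move=> /finite_set_range[m [v [_ ->]]] /conv_hull_range[w ww xE].
by exists (\sum_k w k * f (v k)); apply/graph_hull_range; exists w.
Qed.

Lemma graph_hull_extrema x : finite_set F -> conv_hull F x ->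
  is_min (graph_hull_at F f x) (vex F f x) /\
  is_max (graph_hull_at F f x) (cav F f x).
Proof.
move=> finF xF.
have := @polytope_fiber_extrema R^o (graph_hull F f) id x (fun _ _ _ => erefl)
  (graph_hull_polytope finF) (graph_hull_at_nonempty finF xF).
by rewrite image_id.
Qed.

(** The fibres of the convex set [graph_hull F f] are intervals. *)
Lemma graph_hull_between x z1 z2 z :
  graph_hull F f (x, z1) -> graph_hull F f (x, z2) -> z1 <= z -> z <= z2 ->
  graph_hull F f (x, z).
Proof.
move=> X1 X2 z1z zz2; have [e|ne] := eqVneq z1 z2.
  by have -> : z = z1 by apply/le_anti; rewrite z1z e zz2.
have z12 : 0 < z2 - z1.
  by rewrite subr_gt0 lt_neqAle ne (le_trans z1z zz2).
have nz : z2 - z1 != 0 by rewrite gt_eqF.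
pose t := (z2 - z) / (z2 - z1).
have -> : (x, z) =
    t *: ((x, z1) : 'rV[R]_n * R^o) + (1 - t) *: ((x, z2) : 'rV[R]_n * R^o).
  rewrite [RHS]surjective_pairing /=; congr (_, _).
    by rewrite -scalerDl addrC subrK scale1r.
  by rewrite /t /GRing.scale /=; field.
apply: (iffLR (convex_setP _) (@conv_hull_convex _ _ _)) => //.
  by rewrite divr_ge0 ?(ltW z12) ?subr_ge0.
by rewrite ler_pdivrMr // mul1r; lra.
Qed.

End Fibers.

(** * The projected relaxation *)

Section Projection.
Variables (R : realType) (n : nat) (E : {set upair n}) (a : upair n -> R).

Lemma lin_y_linear : linear (lin_y E a : {ffun upair n -> R^o} -> R^o).
Proof.
move=> c y z; rewrite /lin_y scaler_sumr -big_split; apply: eq_bigr => p _.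
by rewrite !ffunE /GRing.scale /=; ring.
Qed.

(** [LB] and [UB] depend on the polytope only through its projection. *)
Lemma lin_y_fiber (P : set (lifted R n)) x :
  [set lin_y E a y | y in [set y | P (x, y)]] =
  [set z | (proj_f E a @` P) (x, z)].
Proof.
apply/seteqP; split=> [_ [y Py <-] | z [[u y] Py [<- <-]]].
  by exists (x, y).
by exists y.
Qed.

End Projection.

Theorem theorem6p3 (R : realType) (n : nat) (F : set 'rV[R]_n)
    (E : {set upair n}) (a : upair n -> R) (finF : finite_set F) :
  [/\ forall x : 'rV[R]_n, conv_hull F x ->
        is_min (graph_hull_at F (bilin E a) x) (vex F (bilin E a) x) /\
        is_min [set sum_overlap E a S | S in Z_bar F x] (vex F (bilin E a) x),
      forall x : 'rV[R]_n, conv_hull F x ->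
        is_max (graph_hull_at F (bilin E a) x) (cav F (bilin E a) x) /\
        is_max [set sum_overlap E a S | S in Z_bar F x] (cav F (bilin E a) x)
    & forall P : set (lifted R n), polytope P ->
        (forall p : lifted R n, P p -> conv_hull F p.1) ->
        graph_hull F (bilin E a) `<=` proj_f E a @` P ->
        (proj_f E a @` P = graph_hull F (bilin E a) <->
         forall x : 'rV[R]_n, conv_hull F x ->
           exists S S' : 'I_n -> rfamily R,
             [/\ Z_bar F x S, Z_bar F x S',
                 sum_overlap E a S = LB E a P x
               & sum_overlap E a S' = UB E a P x])].
Proof.
have XE x := graph_hull_overlaps E a x finF.
have extrema x := @graph_hull_extrema R n F (bilin E a) x finF.
split=> [x /extrema[minX _] | x /extrema[_ maxX] | P polyP domP XP].
- by rewrite -XE.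
- by rewrite -XE.
split=> [PX x xF | bounds].
  have [[vexX _] [cavX _]] := extrema x xF.
  move: vexX cavX; rewrite XE => -[S SZ Svex] [S' SZ' Scav].
  by exists S, S'; rewrite /LB /UB lin_y_fiber PX.
(* The height of a projected point lies between [LB] and [UB], which are heights
   of points of the graph hull since overlaps are. *)
apply/seteqP; split=> // _ [[x y] Pxy <-].
have [S [S' [SZ SZ' SLB SUB]]] := bounds x (domP _ Pxy).
have inX T : Z_bar F x T -> graph_hull F (bilin E a) (x, sum_overlap E a T).
  by move=> TZ; suff : graph_hull_at F (bilin E a) x (sum_overlap E a T) by [];
    rewrite XE; exists T.
have [[_ LBy] [_ UBy]] := polytope_fiber_extrema (@lin_y_linear R n E a) polyP
  (ex_intro _ y Pxy).
apply: (graph_hull_between (inX _ SZ) (inX _ SZ')).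
  by rewrite SLB; apply: LBy; exists y.
by rewrite SUB; apply: UBy; exists y.
Qed.
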